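(* Let $A\in C^1(\mathbb{R}^n,\mathbb{R}^m)$, $D\in\mathbb{R}^{\ell\times n}$, $b\in\mathbb{R}^m$, $\sigma>0$, and suppose that the joint objective $f_{\mathrm{joint}}$ is strictly convex and coercive on $\mathbb{R}^n\times\mathbb{R}^\ell$ for $\mu=0$. Let $\mu,\lambda>0$ be sufficiently large, i.e. the following holds for all $\mu\ge\mu_0$ and $\lambda\ge\lambda_0$ for some $\mu_0,\lambda_0>0$ depending on $A,b,D,\sigma$. Consider the nonlinear variable projected augmented Lagrangian (VPAL) algorithm described in the context, and assume that all preconditioners $P$ used in it are symmetric positive definite, that there is a constant $\beta>0$ such that the angle condition $$-\frac{g^\top s}{\|g\|_2\,\|s\|_2}\ \ge\ \beta$$ holds for the gradient $g\neq 0$ and search direction $s=-P^{-1}g$ of every (inner and outer) iteration, and that every step size $\alpha$ is the exact step size, i.e. a minimizer over $\alpha>0$ of $\alpha\mapsto f_{\mathrm{proj}}(x+\alpha s)$. Then the iterates $x_k$ produced by the algorithm converge, as $k\to\infty$, to the unique minimizer $\hat x$ of the generalized Lasso problem $$\min_{x\in\mathbb{R}^n}\ \tfrac{1}{2\sigma^2}\|A(x)-b\|_2^2+\mu\|Dx\|_1 .$$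
   Context: For $z\in\mathbb{R}^\ell$, $\lambda>0$, $\mu\ge 0$, define on $\mathbb{R}^n\times\mathbb{R}^\ell$ $$f_{\mathrm{joint}}(x,y)=\tfrac{1}{2\sigma^2}\|A(x)-b\|_2^2+\tfrac{\lambda^2}{2}\|Dx-y+z\|_2^2+\mu\|y\|_1 .$$ ''$f_{\mathrm{joint}}$ for $\mu=0$'' means this function with the last term dropped. A function is coercive if it tends to $+\infty$ as the norm of its argument tends to $\infty$. The shrinkage (soft-thresholding) map $y_z:\mathbb{R}^n\to\mathbb{R}^\ell$ is, componentwise, $$[y_z(x)]_i=\operatorname{sign}([Dx+z]_i)\,\max\{|[Dx+z]_i|-\mu/\lambda^2,\,0\},$$ which is the unique minimizer of $y\mapsto f_{\mathrm{joint}}(x,y)$. The projected objective is $f_{\mathrm{proj}}(x)=f_{\mathrm{joint}}(x,y_z(x))$; its gradient is $$\nabla f_{\mathrm{proj}}(x)=\tfrac{1}{\sigma^2}J_A(x)^\top(A(x)-b)+\lambda^2D^\top(Dx-y_z(x)+z),$$ i.e. $\nabla_x f_{\mathrm{joint}}(x,y)$ evaluated at $y=y_z(x)$, where $J_A$ is the Jacobian of $A$. VPAL algorithm. Initialize $x_0=0$, $y_0=0$, $z_0=0$. For $k=0,1,2,\dots$ (outer loop), with $z=z_k$ in $f_{\mathrm{joint}}$, $f_{\mathrm{proj}}$ and $y_z$: 1. Inner loop: set $x^0=x_k$; for $j=0,1,2,\dots$ let $g^j=\nabla f_{\mathrm{proj}}(x^j)$, choose a symmetric positive definite matrix $P=P_k^j\in\mathbb{R}^{n\times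 n}$, set $s^j=-P^{-1}g^j$, choose the step size $\alpha^j$, and set $x^{j+1}=x^j+\alpha^js^j$ (if $g^j=0$ the inner loop stops at $x^j$). The inner loop is run to convergence, and $x_{k+1}$ is defined as the limit of the inner iterates $x^j$ (this limit existing is part of the assertion), with $y_{k+1}=y_{z_k}(x_{k+1})$. 2. Multiplier update: $z_{k+1}=Dx_{k+1}-y_{k+1}+z_k$. *)

(* Defs.v *)
From HB Require Import structures.
From mathcomp Require Export all_boot all_order all_algebra.
From mathcomp Require Export all_classical all_reals all_analysis.
Set Implicit Arguments.
Unset Strict Implicit.
Unset Printing Implicit Defensive.
Import Order.TTheory GRing.Theory Num.Theory.
Export numFieldNormedType.Exports.
Local Open Scope classical_set_scope.
Local Open Scope ring_scope.

(* The norm `|v| of the library is the sup norm, on column vectors as well as on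
   pairs of them.  It is used only where the choice of norm is immaterial
   (topology, coercivity); the norms of the objective are these. *)
Definition dot (R : realType) (n : nat) (u v : 'cV[R]_n) : R :=
  \sum_(i < n) u i 0 * v i 0.

Definition norm2 (R : realType) (n : nat) (v : 'cV[R]_n) : R :=
  Num.sqrt (dot v v).

Definition norm1 (R : realType) (n : nat) (v : 'cV[R]_n) : R :=
  \sum_(i < n) `|v i 0|.

Definition strictly_convex (R : realType) (V : lmodType R) (f : V -> R) : Prop :=
  forall (u v : V) (t : R), u != v -> 0 < t -> t < 1 ->
    f (t *: u + (1 - t) *: v) < t * f u + (1 - t) * f v.

Definition coercive (R : realType) (V : normedModType R) (f : V -> R) : Prop :=
  forall M : R, exists r : R, forall v : V, r <= `|v| -> M <= f v.

Definition is_minimizer (R : realType) (T : Type) (f : T -> R) (x : T) : Prop :=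
  forall x' : T, f x <= f x'.

(* The library's 'J acts on row vectors; this is the usual m x n matrix of
   partial derivatives for maps between column vectors. *)
Definition Jacobian (R : realType) (n m : nat) (A : 'cV[R]_n -> 'cV[R]_m)
    (x : 'cV[R]_n) : 'M[R]_(m, n) :=
  \matrix_(i, j) ('d A x (delta_mx j 0 : 'cV[R]_n)) i 0.

Definition C1 (R : realType) (n m : nat) (A : 'cV[R]_n -> 'cV[R]_m) : Prop :=
  (forall x, differentiable A x) /\ continuous (Jacobian A).

Definition gradient (R : realType) (n : nat) (f : 'cV[R]_n -> R)
    (x : 'cV[R]_n) : 'cV[R]_n :=
  \col_i 'D_(delta_mx i 0 : 'cV[R]_n) f x.

Definition spd (R : realType) (n : nat) (P : 'M[R]_n) : Prop :=
  P^T = P /\ forall v : 'cV[R]_n, v != 0 -> 0 < dot v (P *m v).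

Definition fjoint (R : realType) (n m l : nat) (A : 'cV[R]_n -> 'cV[R]_m)
    (D : 'M[R]_(l, n)) (b : 'cV[R]_m) (sigma lambda mu : R) (z : 'cV[R]_l)
    (x : 'cV[R]_n) (y : 'cV[R]_l) : R :=
  1 / (2 * sigma ^+ 2) * norm2 (A x - b) ^+ 2
  + lambda ^+ 2 / 2 * norm2 (D *m x - y + z) ^+ 2 + mu * norm1 y.

Definition shrink (R : realType) (n l : nat) (D : 'M[R]_(l, n))
    (lambda mu : R) (z : 'cV[R]_l) (x : 'cV[R]_n) : 'cV[R]_l :=
  \col_i (Num.sg ((D *m x + z) i 0)
          * Num.max (`|(D *m x + z) i 0| - mu / lambda ^+ 2) 0).

Definition fproj (R : realType) (n m l : nat) (A : 'cV[R]_n -> 'cV[R]_m)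
    (D : 'M[R]_(l, n)) (b : 'cV[R]_m) (sigma lambda mu : R) (z : 'cV[R]_l)
    (x : 'cV[R]_n) : R :=
  fjoint A D b sigma lambda mu z x (shrink D lambda mu z x).

Definition lasso (R : realType) (n m l : nat) (A : 'cV[R]_n -> 'cV[R]_m)
    (D : 'M[R]_(l, n)) (b : 'cV[R]_m) (sigma mu : R) (x : 'cV[R]_n) : R :=
  1 / (2 * sigma ^+ 2) * norm2 (A x - b) ^+ 2 + mu * norm1 (D *m x).

Definition direction (R : realType) (n : nat) (f : 'cV[R]_n -> R)
    (P : 'M[R]_n) (x : 'cV[R]_n) : 'cV[R]_n :=
  - (invmx P *m gradient f x).

(* Iterates xs of the preconditioned descent for f from x0.  Stopping at a
   stationary point is encoded by keeping the sequence constant from there on;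
   nothing is then required of the later P j and alpha j. *)
Definition inner_loop (R : realType) (n : nat) (f : 'cV[R]_n -> R)
    (x0 : 'cV[R]_n) (xs : nat -> 'cV[R]_n) (P : nat -> 'M[R]_n)
    (alpha : nat -> R) : Prop :=
  xs 0%N = x0 /\
  forall j : nat,
    (gradient f (xs j) = 0 -> xs j.+1 = xs j) /\
    (gradient f (xs j) <> 0 ->
       spd (P j) /\ xs j.+1 = xs j + alpha j *: direction f (P j) (xs j)).

Definition angle_condition (R : realType) (n : nat) (f : 'cV[R]_n -> R)
    (xs : nat -> 'cV[R]_n) (P : nat -> 'M[R]_n) (beta : R) : Prop :=
  forall j : nat, gradient f (xs j) <> 0 ->
    let g := gradient f (xs j) in
    let s := direction f (P j) (xs j) in
    beta <= - (dot g s / (norm2 g * norm2 s)).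

Definition exact_steps (R : realType) (n : nat) (f : 'cV[R]_n -> R)
    (xs : nat -> 'cV[R]_n) (P : nat -> 'M[R]_n) (alpha : nat -> R) : Prop :=
  forall j : nat, gradient f (xs j) <> 0 ->
    let s := direction f (P j) (xs j) in
    0 < alpha j /\
    forall a : R, 0 < a -> f (xs j + alpha j *: s) <= f (xs j + a *: s).

(* xin k j, P k j and alpha k j are the j-th inner iterate, preconditioner and
   step size of the k-th outer iteration.  The operator lim is total, so a run
   does not presuppose that the inner iterates converge. *)
Definition vpal (R : realType) (n m l : nat) (A : 'cV[R]_n -> 'cV[R]_m)
    (D : 'M[R]_(l, n)) (b : 'cV[R]_m) (sigma lambda mu : R)
    (x : nat -> 'cV[R]_n) (y z : nat -> 'cV[R]_l)
    (xin : nat -> nat -> 'cV[R]_n) (P : nat -> nat -> 'M[R]_n)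
    (alpha : nat -> nat -> R) : Prop :=
  [/\ x 0%N = 0, y 0%N = 0, z 0%N = 0 &
    forall k : nat,
      [/\ inner_loop (fproj A D b sigma lambda mu (z k)) (x k)
            (xin k) (P k) (alpha k),
          x k.+1 = lim (xin k j @[j --> \oo]),
          y k.+1 = shrink D lambda mu (z k) (x k.+1) &
          z k.+1 = D *m x k.+1 - y k.+1 + z k]].

(* Main.v *)
(* The data fit h is strictly convex and coercive: restrict f_joint (mu = 0) to the
   graph y = Dx + z.  So any mu0, lambda0 > 0 will do; we take 1.

   Inner loop: f_proj is h plus the Moreau envelope of mu |.|_1, hence has a
   continuous subgradient selection G, which is then its gradient.  The angle
   condition and the exact step give a decrease of f_proj bounded below near any
   point where G <> 0, so by compactness of sublevel sets the iterates converge
   to the unique minimizer.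

   Outer loop: optimality of x_{k+1} and y_{k+1} says that (x_{k+1}, y_{k+1})
   minimizes the Lagrangian L(., ., z_{k+1}), i.e. its value d_k there is the dual
   function at z_{k+1}.  With r_k = D x_{k+1} - y_{k+1} = z_{k+1} - z_k one gets
   d_k + lambda^2 |r_{k+1}|^2 <= d_{k+1} <= min lasso, so r_k -> 0.  Since
   |z_{k+1}|_oo <= mu / lambda^2, weak duality d_k <= min lasso then makes x_k a
   minimizing sequence of the lasso objective. *)
Require Import Defs.
From mathcomp Require Import ring lra.
Set Implicit Arguments.
Unset Strict Implicit.
Unset Printing Implicit Defensive.
Import Order.TTheory GRing.Theory Num.Theory.
Local Open Scope classical_set_scope.
Local Open Scope ring_scope.

(** * Entrywise bounds and continuity of matrix-valued maps *)

Lemma normmx_ge_coord (R : realType) (m n : nat) (v : 'M[R]_(m, n)) i j :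
  `|v i j| <= `|v|.
Proof.
rewrite [leRHS]/Num.Def.normr/= mx_normrE.
exact: (le_bigmax _ (fun ij : 'I_m * 'I_n => `|v ij.1 ij.2|) (i, j)).
Qed.

Lemma normmx_le (R : realType) (m n : nat) (v : 'M[R]_(m, n)) (c : R) :
  0 <= c -> (forall i j, `|v i j| <= c) -> `|v| <= c.
Proof.
move=> c0 vc; rewrite [leLHS]/Num.Def.normr/= mx_normrE.
by apply: bigmax_le => // -[i j] _ /=.
Qed.

Lemma continuous_mx (R : realType) (T : topologicalType) (m n : nat)
    (f : T -> 'M[R]_(m, n)) :
  (forall i j, continuous (fun x => f x i j)) -> continuous f.
Proof.
move=> cf x; apply/cvgrPdist_le => /= e e0; near=> y.
apply: normmx_le => [|i j]; first exact: ltW.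
rewrite !mxE; move: i j; near: y.
apply: filter_forall => i; apply: filter_forall => j.
by have /cvgrPdist_le/(_ _ e0) := cf i j x.
Unshelve. all: by end_near. Qed.

Lemma continuous_coord (R : realType) (T : topologicalType) (m n : nat)
    (f : T -> 'M[R]_(m, n)) i j :
  continuous f -> continuous (fun x => f x i j).
Proof.
move=> cf x; apply: (@continuous_comp _ _ _ f (fun M : 'M[R]_(m, n) => M i j)).
  exact: cf.
exact: coord_continuous.
Qed.

Lemma continuous_bigsum (R : realType) (T : topologicalType) (I : finType)
    (f : I -> T -> R) :
  (forall i, continuous (f i)) -> continuous (fun x => \sum_i f i x).
Proof.
move=> cf x; rewrite -fct_sumE.
elim/big_ind: _ => [|g h cg ch|i _]; [exact: cvg_cst|exact: cvgD|exact: cf].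
Qed.

Lemma continuous_mulmx (R : realType) (T : topologicalType) (m n p : nat)
    (f : T -> 'M[R]_(m, n)) (g : T -> 'M[R]_(n, p)) :
  continuous f -> continuous g -> continuous (fun x => f x *m g x).
Proof.
move=> cf cg; apply: continuous_mx => i j.
under eq_fun do rewrite mxE.
apply: continuous_bigsum => k x.
by apply: cvgM; apply: continuous_coord.
Qed.

Lemma continuous_mulmxl (R : realType) (m n p : nat) (M : 'M[R]_(m, n)) :
  continuous (fun x : 'M[R]_(n, p) => M *m x).
Proof.
have cM : continuous (fun _ : 'M[R]_(n, p) => M) by exact: cst_continuous.
by apply: (continuous_mulmx cM) => x; exact: cvg_id.
Qed.

Lemma continuous_trmx (R : realType) (T : topologicalType) (m n : nat)
    (f : T -> 'M[R]_(m, n)) :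
  continuous f -> continuous (fun x => (f x)^T).
Proof.
move=> cf; apply: continuous_mx => i j.
under eq_fun do rewrite mxE.
exact: continuous_coord.
Qed.

(** * Compactness, existence of minimizers and minimizing sequences *)

Lemma bounded_closed_compact_cV (R : realType) (n : nat) (M : R)
    (K : set 'cV[R]_n) :
  closed K -> (forall v, K v -> `|v| <= M) -> compact K.
Proof.
move=> Kcl KM.
(* The cube of row vectors is a product of segments; transposition carries it to a compact set of
   columns that contains [K]. *)
pose B := [set v : 'rV[R]_n | forall i, `[- M, M]%classic (v ord0 i)].
have cB : compact B.
  by apply: (@rV_compact _ _ (fun=> `[- M, M]%classic)) => _; exact: segment_compact.
have cBT : compact ((fun v : 'rV[R]_n => v^T) @` B).
  apply: continuous_compact => //; apply: continuous_subspaceT.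
  by apply: continuous_trmx => x; exact: cvg_id.
apply: subclosed_compact Kcl cBT _ => v Kv; exists v^T; last by rewrite trmxK.
move=> i /=; rewrite in_itv /= -ler_norml mxE.
exact: le_trans (normmx_ge_coord _ _ _) (KM _ Kv).
Qed.

Lemma closed_sublevel (R : realType) (T : topologicalType) (f : T -> R) (c : R) :
  continuous f -> closed [set x | f x <= c].
Proof.
move=> cf; apply: (@preimage_closed _ _ f [set y | y <= c]) => [x _|]; first exact: cf.
exact: closed_le.
Qed.

Lemma coercive_sublevel_compact (R : realType) (n : nat) (f : 'cV[R]_n -> R)
    (c : R) :
  continuous f -> coercive f -> compact [set x | f x <= c].
Proof.
move=> cf /(_ (c + 1))[r fr].
apply: (@bounded_closed_compact_cV _ _ r); first exact: closed_sublevel.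
move=> v /= fvc; rewrite leNgt; apply/negP => /ltW/fr; lra.
Qed.

Lemma compact_min (R : realType) (T : topologicalType) (f : T -> R) (K : set T) :
  continuous f -> compact K -> K !=set0 ->
  exists2 c, K c & forall x, K x -> f c <= f x.
Proof.
move=> cf cK K0.
have [|c /set_mem Kc cmin] := compact_EVT_min K0 cK (f := f).
  exact: continuous_subspaceT.
by exists c => // x Kx; apply: cmin; exact/mem_set.
Qed.

Lemma coercive_minimizer (R : realType) (n : nat) (f : 'cV[R]_n -> R) :
  continuous f -> coercive f -> exists x, is_minimizer f x.
Proof.
move=> cf fco.
have [|c fc cmin] := compact_min cf (coercive_sublevel_compact (c := f 0) cf fco).
  by exists 0 => /=.
by exists c => x; case: (leP (f x) (f 0)) => [/cmin//|/ltW]; exact: le_trans.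
Qed.

(** Outside a ball about [xhat], a sublevel set is compact, so [f] attains a minimum there, and
    uniqueness puts it strictly above [f xhat]. Values close enough to [f xhat] therefore force the
    sequence into the ball. Both loops conclude with this. *)
Lemma minimizing_sequence_cvg (R : realType) (n : nat) (f : 'cV[R]_n -> R)
    (xhat : 'cV[R]_n) (u : nat -> 'cV[R]_n) :
  continuous f -> coercive f -> (forall x, f x <= f xhat -> x = xhat) ->
  (forall e, 0 < e -> \forall k \near \oo, f (u k) <= f xhat + e) ->
  u k @[k --> \oo] --> xhat.
Proof.
move=> cf fco xuniq fu; apply/cvgrPdist_lt => /= e e0.
pose K := [set x | f x <= f xhat + 1] `&` ~` ball xhat e.
have cK : compact K.
  apply: compact_closedI; first exact: coercive_sublevel_compact.
  by apply: open_closedC; exact: ball_open.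
have [K0|/set0P K0] := eqVneq K set0.
  have := fu 1 ltr01; apply: filterS => k fk.
  have : ~ K (u k) by rewrite K0.
  by move=> /not_andP[//|/contrapT]; rewrite -ball_normE.
have [c [/= _ cfar] cmin] := compact_min cf cK K0.
have fc : f xhat < f c.
  rewrite ltNge; apply/negP => /xuniq cE; apply: cfar; rewrite cE.
  exact: ballxx.
have f1 := fu 1 ltr01.
(* Half the gap: a point with value at most [f xhat] plus this lies below the minimum over [K]. *)
have fc2 : 0 < (f c - f xhat) / 2 by lra.
have f2 := fu _ fc2.
near=> k.
have fk1 : f (u k) <= f xhat + 1 by near: k.
have fk2 : f (u k) <= f xhat + (f c - f xhat) / 2 by near: k.
have [ball_uk|nball] := pselect (ball xhat e (u k)).
  by move: ball_uk; rewrite -ball_normE.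
by have := cmin _ (conj fk1 nball); lra.
Unshelve. all: by end_near. Qed.

(** * The Euclidean inner product and its comparison with the sup norm *)

Section Dot.
Variables (R : realType) (n : nat).
Implicit Types u v w : 'cV[R]_n.

Lemma dotC u v : dot u v = dot v u.
Proof. by apply: eq_bigr => i _; rewrite mulrC. Qed.

Lemma dotDr u v w : dot u (v + w) = dot u v + dot u w.
Proof. by rewrite -big_split; apply: eq_bigr => i _; rewrite mxE mulrDr. Qed.

Lemma dotZr (a : R) u v : dot u (a *: v) = a * dot u v.
Proof. by rewrite mulr_sumr; apply: eq_bigr => i _; rewrite mxE mulrCA. Qed.

Lemma dotNr u v : dot u (- v) = - dot u v.
Proof. by rewrite -scaleN1r dotZr mulN1r. Qed.

Lemma dotBr u v w : dot u (v - w) = dot u v - dot u w.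
Proof. by rewrite dotDr dotNr. Qed.

Lemma dotDl u v w : dot (u + v) w = dot u w + dot v w.
Proof. by rewrite dotC dotDr !(dotC w). Qed.

Lemma dotZl (a : R) u v : dot (a *: u) v = a * dot u v.
Proof. by rewrite dotC dotZr dotC. Qed.

Lemma dotNl u v : dot (- u) v = - dot u v.
Proof. by rewrite dotC dotNr dotC. Qed.

Lemma dotBl u v w : dot (u - v) w = dot u w - dot v w.
Proof. by rewrite dotDl dotNl. Qed.

Lemma dot0l v : dot 0 v = 0.
Proof. by rewrite -(scale0r v) dotZl mul0r. Qed.

Lemma dot_delta u i : dot u (delta_mx i 0) = u i 0.
Proof.
rewrite /dot (bigD1 i) //= mxE !eqxx mulr1 big1 ?addr0 // => j /negbTE ji.
by rewrite mxE ji mulr0.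
Qed.

Lemma dot_ge0 v : 0 <= dot v v.
Proof. by apply: sumr_ge0 => i _; rewrite -expr2 sqr_ge0. Qed.

Lemma norm2_sqr v : norm2 v ^+ 2 = dot v v.
Proof. by rewrite sqr_sqrtr // dot_ge0. Qed.

Lemma dot_le_norm u v : `|dot u v| <= n%:R * `|u| * `|v|.
Proof.
have -> : n%:R * `|u| * `|v| = \sum_(i < n) `|u| * `|v|.
  by rewrite sumr_const card_ord -mulrA mulr_natl.
apply: (le_trans (ler_norm_sum _ _ _)); apply: ler_sum => i _.
by rewrite normrM ler_pM ?normmx_ge_coord.
Qed.

Lemma norm_le_norm2 v : `|v| <= norm2 v.
Proof.
apply: normmx_le => [|i j]; first exact: sqrtr_ge0.
rewrite ord1 -sqrtr_sqr; apply: ler_wsqrtr.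
rewrite /dot (bigD1 i) //= expr2 lerDl.
by apply: sumr_ge0 => k _; rewrite -expr2 sqr_ge0.
Qed.

End Dot.

Lemma dot_mulmxr (R : realType) (m n : nat) (M : 'M[R]_(m, n)) u v :
  dot u (M *m v) = dot (M^T *m u) v.
Proof.
have dotE k (p q : 'cV[R]_k) : dot p q = (p^T *m q) 0 0.
  by rewrite mxE; apply: eq_bigr => i _; rewrite mxE.
by rewrite !dotE trmx_mul trmxK mulmxA.
Qed.

Lemma continuous_dot (R : realType) (T : topologicalType) (n : nat)
    (f g : T -> 'cV[R]_n) :
  continuous f -> continuous g -> continuous (fun x => dot (f x) (g x)).
Proof.
move=> cf cg; apply: continuous_bigsum => k x.
by apply: cvgM; apply: continuous_coord.
Qed.

(** * Convex functions with a continuous subgradient selection *)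

Definition is_subgradient (R : realType) (n : nat) (f : 'cV[R]_n -> R)
    (G : 'cV[R]_n -> 'cV[R]_n) : Prop :=
  forall u v : 'cV[R]_n, f u + dot (G u) (v - u) <= f v.

Section Subgradient.
Variables (R : realType) (n : nat) (f : 'cV[R]_n -> R).
Variable G : 'cV[R]_n -> 'cV[R]_n.
Hypotheses (fG : is_subgradient f G) (cG : continuous G).

(* The difference quotient of [f] lies between the values at [x] and at
   [x + h v] of the directional subgradient. *)
Lemma subgradient_derive x v : 'D_v f x = dot (G x) v.
Proof.
apply: cvg_lim => //; apply/cvgrPdist_le => /= e e0.
pose d (h : R) := dot (G (h *: v + x)) v.
have cd : continuous d.
  apply: continuous_dot => [h|h]; last exact: cvg_cst.
  apply: (@continuous_comp _ _ _ (fun h : R => h *: v + x) G); last exact: cG.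
  by apply: cvgD; [apply: cvgZr_tmp; exact: cvg_id|exact: cvg_cst].
have d0 : d 0 = dot (G x) v by rewrite /d scale0r add0r.
have /cvgrPdist_le/(_ _ e0)/nbhs_dnbhs dnear : d h @[h --> 0] --> d 0 by exact: cd.
near=> h.
have h0 : h != 0 by near: h; exact: nbhs_dnbhs_neq.
have hd : `|d 0 - d h| <= e by near: h; exact: dnear.
rewrite d0 in hd.
have := fG x (h *: v + x); have := fG (h *: v + x) x.
rewrite addrK opprD addrCA subrr addr0 dotNr !dotZr -/(d h) => lo hi.
set q := _ *: _.
have qE : f (h *: v + x) = f x + h * q.
  by rewrite /q /= /GRing.scale /= mulVKf // [RHS]addrC subrK.
move: lo hi hd; rewrite qE {qE} !ler_norml; move: q (dot _ _) (d h) => q a b.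
move=> lo hi /andP[h1 h2]; have [hpos|hneg|h00] := ltgtP h 0; last by rewrite h00 eqxx in h0.
- have : b <= q by nra.
  have : q <= a by nra.
  by move=> *; apply/andP; split; lra.
- have : a <= q by nra.
  have : q <= b by nra.
  by move=> *; apply/andP; split; lra.
Unshelve. all: by end_near. Qed.

Lemma subgradient_gradient : gradient f = G.
Proof.
by apply/funext => x; apply/colP => i; rewrite mxE subgradient_derive dot_delta.
Qed.

Lemma subgradient0_minimizer x : G x = 0 -> is_minimizer f x.
Proof. by move=> Gx0 y; have := fG x y; rewrite Gx0 dot0l addr0. Qed.

(** Near [x] the selection [G] is almost constant. Moving a fixed distance in a direction obeying
    the angle condition thus gains a fixed amount, whatever the starting point near [x] and the
    length of [s]. *)
Lemma uniform_decrease (beta : R) x : 0 < beta -> G x != 0 ->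
  exists2 delta, 0 < delta &
    \forall y \near x, forall s : 'cV[R]_n, s != 0 ->
      beta * (norm2 (G y) * norm2 s) <= - dot (G y) s ->
      exists2 a, 0 < a & f (y + a *: s) <= f y - delta.
Proof.
move=> beta0 Gx0; have g0 : 0 < `|G x| by rewrite normr_gt0.
pose N : R := n%:R; have N0 : 0 <= N by exact: ler0n.
(* Replacing [G x] by [G y] in the angle condition costs [beta * e], and replacing [G y] by
   [G (y + a *: s)] costs [2 * N * e], with [N] from [dot_le_norm]. This [e] makes the two losses
   together half of the slope [beta * |G x|]. *)
pose e := beta * `|G x| / (2 * (beta + 2 * N)).
have bN : 0 < beta + 2 * N by lra.
have e0 : 0 < e by rewrite divr_gt0 ?mulr_gt0.
have eE : beta * e + 2 * N * e = beta * `|G x| / 2.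
  by rewrite /e; field; rewrite gt_eqF.
have /cvgrPdist_le/(_ _ e0)/nbhs_ballP[r /= r0 Gnear] : G y @[y --> x] --> G x by exact: cG.
have r40 : 0 < r / 4 by lra.
exists (r / 4 * (beta * `|G x| / 2)); first by rewrite !mulr_gt0 ?divr_gt0 ?mulr_gt0.
near=> y => s s0 ang.
have xy : `|x - y| < r / 4 by near: y; exact: cvgr_dist_lt.
have s20 : 0 < norm2 s.
  by apply: lt_le_trans (norm_le_norm2 s); rewrite normr_gt0.
(* The displacement has Euclidean length [r / 4], so with [y] within [r / 4] of [x] the end point
   stays in the ball where [G] varies little. *)
exists (r / 4 / norm2 s); first exact: divr_gt0.
set a := r / 4 / norm2 s.
have a0 : 0 < a by exact: divr_gt0.
have as_ : a * norm2 s = r / 4 by rewrite /a divfK // gt_eqF.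
have nas : `|a *: s| <= r / 4.
  by rewrite normrZ gtr0_norm // -as_ ler_pM2l // norm_le_norm2.
have Gy : `|G x - G y| <= e by apply: Gnear; rewrite -ball_normE /=; lra.
have Gya : `|G x - G (y + a *: s)| <= e.
  apply: Gnear; rewrite -ball_normE /= opprD addrA.
  by apply: le_lt_trans (ler_normB _ _) _; lra.
have Gdiff : `|G (y + a *: s) - G y| <= 2 * e.
  rewrite -(subrKA (G x)) -opprB addrC.
  by apply: le_trans (ler_normB _ _) _; lra.
have Gyx : `|G x| - e <= norm2 (G y).
  apply: le_trans (norm_le_norm2 _); have := ler_normD (G x - G y) (G y).
  by rewrite subrK; lra.
(* The subgradient is taken at the end point, which bounds the value there from above. *)
have := fG (y + a *: s) y.
rewrite opprD addrA subrr add0r dotNr.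
rewrite -(subrK (G y) (G (y + a *: s))) dotDl dotZr (dotZr a (G y)).
have := dot_le_norm (G (y + a *: s) - G y) (a *: s).
rewrite dotZr ler_norml => /andP[_ lo].
have lo2 : n%:R * `|G (y + a *: s) - G y| * `|a *: s| <= N * (2 * e) * (r / 4).
  by rewrite ler_pM ?mulr_ge0 // ler_wpM2l.
have ang2 : beta * (`|G x| - e) * (r / 4) <= - (a * dot (G y) s).
  apply: (@le_trans _ _ (beta * norm2 (G y) * (r / 4))).
    by rewrite ler_pM2r // ler_pM2l.
  rewrite -as_ -mulrN [leLHS](_ : _ = a * (beta * (norm2 (G y) * norm2 s))).
    by rewrite ler_pM2l.
  by ring.
move: eE lo lo2 ang2; set q := a * dot _ s; set p := a * dot _ s.
move: (n%:R * _ * _) => B.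
move=> eE lo lo2 ang2 main.
have : N * (2 * e) * (r / 4) + beta * e * (r / 4) = r / 4 * (beta * `|G x| / 2).
  by rewrite -eE; ring.
rewrite -/q -/p in main *. lra.
Unshelve. all: by end_near. Qed.

(** The direction [- G x] meets the angle condition with constant 1, so a nonzero [G x] would give a
    lower value. *)
Lemma minimizer_subgradient0 x : is_minimizer f x -> G x = 0.
Proof.
move=> xmin; apply/eqP; apply: contraPT xmin => Gx0 xmin.
have [delta delta0 /nbhs_singleton/(_ (- G x))] := uniform_decrease ltr01 Gx0.
rewrite oppr_eq0 mul1r dotNr opprK => /(_ Gx0)[|a _ dec].
  by rewrite /norm2 dotNr dotNl opprK -expr2 norm2_sqr.
by have := xmin (x + a *: - G x); lra.
Qed.

End Subgradient.

(** The two subgradient inequalities squeeze [f y] between [f x + dot (G x) (y - x)] and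
    [f x + dot (G y) (y - x)], both tending to [f x]. *)
Lemma subgradient_continuous (R : realType) (n : nat) (f : 'cV[R]_n -> R)
    (G : 'cV[R]_n -> 'cV[R]_n) :
  is_subgradient f G -> continuous G -> continuous f.
Proof.
move=> fG cG; suff cfx (x : 'cV[R]_n) : f y @[y --> x] --> f x by exact: cfx.
have c (F : 'cV[R]_n -> 'cV[R]_n) : continuous F ->
    f x + dot (F y) (y - x) @[y --> x] --> f x.
  move=> cF; have fxE : f x = f x + dot (F x) (x - x).
    by rewrite subrr dotC dot0l addr0.
  have cid : continuous (fun y : 'cV[R]_n => y - x).
    by move=> y; exact: (cvgB (@cvg_id _ _) (cvg_cst x)).
  have cd := continuous_dot cF cid.
  have : f x + dot (F y) (y - x) @[y --> x] --> f x + dot (F x) (x - x).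
    by apply: cvgD (cd x); apply: cvg_cst.
  by rewrite -fxE.
have cGx : continuous (fun _ : 'cV[R]_n => G x) by exact: cst_continuous.
apply: squeeze_cvgr (c _ cGx) (c G cG).
by near=> y; rewrite fG /=; have := fG y x; rewrite -opprB dotNr; lra.
Unshelve. all: by end_near. Qed.

(** * Convergence of preconditioned descent with exact steps *)

Lemma direction_neq0 (R : realType) (n : nat) (f : 'cV[R]_n -> R) P x :
  spd P -> gradient f x != 0 -> direction f P x != 0.
Proof.
move=> [_ Ppos] g0; rewrite oppr_eq0; apply/eqP => Pg0.
(* [invmx P] is [P] itself if [P] is singular. *)
have [Pu|Pnu] := boolP (P \in unitmx).
  by case/eqP: g0; rewrite -(mulKVmx Pu (gradient f x)) Pg0 mulmx0.
have := Ppos _ g0; move: Pg0; rewrite /invmx (negbTE Pnu) => ->.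
by rewrite dotC dot0l ltxx.
Qed.

Section Descent.
Variables (R : realType) (n : nat) (f : 'cV[R]_n -> R).
Variable G : 'cV[R]_n -> 'cV[R]_n.
Hypotheses (fG : is_subgradient f G) (cG : continuous G).
Variables (x0 : 'cV[R]_n) (xs : nat -> 'cV[R]_n) (P : nat -> 'M[R]_n).
Variables (alpha : nat -> R) (beta : R).
Hypotheses (beta_gt0 : 0 < beta) (xs_loop : inner_loop f x0 xs P alpha).
Hypotheses (xs_angle : angle_condition f xs P beta).
Hypotheses (xs_exact : exact_steps f xs P alpha).

(** The exact step does at least as well as the step supplied by [uniform_decrease], so it inherits
    the same gain. *)
Lemma exact_step_uniform_decrease x : G x != 0 ->
  exists2 delta, 0 < delta &
    \forall y \near x, forall j, xs j = y -> G y != 0 ->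
      f (xs j.+1) <= f (xs j) - delta.
Proof.
move=> Gx0; have [delta delta0 dec] := uniform_decrease fG cG beta_gt0 Gx0.
exists delta => //; apply: filterS dec => y dec j xj; move: dec; rewrite -{y}xj => dec Gj0.
have gE := subgradient_gradient fG cG.
have gj0 : gradient f (xs j) <> 0 by rewrite gE; exact/eqP.
have [Pspd ->] := (xs_loop.2 j).2 gj0.
have [_ best] := xs_exact gj0.
have s0 : direction f (P j) (xs j) != 0 by apply: direction_neq0 => //; exact/eqP.
have [|a a0] := dec _ s0; last by apply: le_trans; exact: best.
have gt0 (v : 'cV[R]_n) : v != 0 -> 0 < norm2 v.
  by move=> v0; apply: lt_le_trans (norm_le_norm2 v); rewrite normr_gt0.
have := xs_angle gj0; rewrite /= gE => ang.
by rewrite -ler_pdivlMr ?mulr_gt0 ?gt0 // mulNr.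
Qed.

Lemma exact_step_nonincreasing : nonincreasing_seq (f \o xs).
Proof.
apply/nonincreasing_seqP => j /=.
have gE := subgradient_gradient fG cG.
have [Gj0|Gj0] := eqVneq (G (xs j)) 0.
  by rewrite (xs_loop.2 j).1 // gE.
have [delta delta0 /nbhs_singleton/(_ j erefl Gj0)] := exact_step_uniform_decrease Gj0.
by lra.
Qed.

(** Since the values decrease, a single iterate with value near the minimum suffices for each
    tolerance. Otherwise all iterates stay in a compact set on which [G] does not vanish; near a
    cluster point each step gains a fixed [delta], which contradicts the convergence of the
    values. *)
Lemma descent_cvg xhat :
  coercive f -> (forall x, f x <= f xhat -> x = xhat) ->
  xs j @[j --> \oo] --> xhat.
Proof.
move=> fco xuniq; have cf := subgradient_continuous fG cG.
have decr := exact_step_nonincreasing.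
have xmin x : f xhat <= f x.
  by rewrite leNgt; apply/negP => fx; move: (fx); rewrite (xuniq x (ltW fx)) ltxx.
apply: (minimizing_sequence_cvg cf fco xuniq) => e e0.
suff [k fk] : exists k, f (xs k) <= f xhat + e.
  exists k => // j /= kj; apply: le_trans fk; exact: decr.
apply: contrapT => /forallNP far.
have {}far k : f xhat + e <= f (xs k) by rewrite leNgt; apply/negP => /ltW/far.
pose K := [set x | f x <= f (xs 0%N)] `&` [set x | f xhat + e <= f x].
have cK : compact K.
  apply: compact_closedI; first exact: coercive_sublevel_compact.
  apply: (@preimage_closed _ _ f [set y | f xhat + e <= y]) => [x _|]; first exact: cf.
  exact: closed_ge.
have [|x [[/= _ fx] xcl]] := cK (xs @ \oo) _.
  by exists 0%N => // j _; split=> /=; [exact: decr|].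
have G_neq0 y : f xhat + e <= f y -> G y != 0.
  move=> fy; apply/eqP => /(subgradient0_minimizer fG)/(_ xhat); lra.
have [delta delta0 dec] := exact_step_uniform_decrease (G_neq0 x ltac:(lra)).
have cvgf : cvgn (f \o xs).
  by apply: nonincreasing_is_cvgn => //; exists (f xhat) => _ [j _ <-] /=.
have fnear : \forall j \near \oo, f (xs j) < limn (f \o xs) + delta.
  have /cvgrPdist_lt/(_ _ delta0) := cvgf; apply: filterS => j /=.
  by rewrite ltr_norml => /andP[]; lra.
(* Iterates whose value is within [delta] of the limit. One of them lies near the cluster point, and
   its next step goes below the limit of a nonincreasing sequence. *)
pose B := [set y | f y < limn (f \o xs) + delta /\ exists j, xs j = y].
have [|y [[fy [j xj]] decy]] := xcl B _ _ dec.
  by apply: filterS fnear => j fj; split => //; exists j.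
have Gy0 : G y != 0 by rewrite -xj; exact: G_neq0.
have := decy j xj Gy0; rewrite xj => fj.
have := nonincreasing_cvgn_ge decr cvgf j.+1; rewrite /=; lra.
Qed.

End Descent.

(** * First-order consequences of strict convexity *)

Lemma strictly_convex_minimizer_uniq (R : realType) (V : lmodType R) (f : V -> R)
    (xhat x : V) :
  strictly_convex f -> is_minimizer f xhat -> f x <= f xhat -> x = xhat.
Proof.
move=> fconv xmin fx; apply/eqP; apply: contraTT isT => xx.
have half0 : (0 : R) < 1 / 2 by lra.
have half1 : (1 / 2 : R) < 1 by lra.
have := fconv _ _ _ xx half0 half1; have := xmin (1 / 2 *: x + (1 - 1 / 2) *: xhat).
by lra.
Qed.

(** Compare at the midpoint: the subgradient inequality bounds its value from below, strict
    convexity bounds it strictly from above. *)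
Lemma strictly_convex_subgradient_lt (R : realType) (n : nat)
    (f : 'cV[R]_n -> R) (G : 'cV[R]_n -> 'cV[R]_n) (u v : 'cV[R]_n) :
  strictly_convex f -> is_subgradient f G -> u != v ->
  f u + dot (G u) (v - u) < f v.
Proof.
move=> fconv fG uv.
have half0 : (0 : R) < 1 / 2 by lra.
have half1 : (1 / 2 : R) < 1 by lra.
have := fconv _ _ _ uv half0 half1.
have := fG u (1 / 2 *: u + (1 - 1 / 2) *: v).
rewrite (_ : _ - u = (1 / 2) *: (v - u)); last first.
  by apply/colP => i; rewrite !mxE; field.
by rewrite dotZr; lra.
Qed.

(** For [0 < t < 1] convexity bounds the difference quotient along the segment by [f v - f u]; let
    [t] tend to 0 from the right. *)
Lemma strictly_convex_derive_le (R : realType) (V : normedModType R) (f : V -> R)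
    (u v : V) :
  strictly_convex f -> derivable f u (v - u) -> f u + 'D_(v - u) f u <= f v.
Proof.
move=> fconv df; have [->|uv] := eqVneq u v.
  by rewrite subrr derive0 addr0.
rewrite -lerBrDl; move/cvg_dnbhs_at_right: df => df.
apply: cvgr_to_le df _; near=> t.
have t0 : 0 < t by near: t; exact: nbhs_right_gt.
have t1 : t < 1 by near: t; exact: nbhs_right_lt.
have := fconv v u t _ t0 t1; rewrite eq_sym => /(_ uv).
rewrite (_ : t *: v + (1 - t) *: u = t *: (v - u) + u); last first.
  by rewrite scalerBr scalerBl scale1r addrA addrAC.
by move=> ineq; rewrite /= /GRing.scale /= ler_pdivrMl //; lra.
Unshelve. all: by end_near. Qed.

(** * The data fit and its gradient *)

Lemma Jacobian_mulE (R : realType) (n m : nat) (A : 'cV[R]_n -> 'cV[R]_m) x v :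
  'd A x v = Jacobian A x *m v.
Proof.
rewrite {1}(_ : v = \sum_j v j 0 *: (delta_mx j 0 : 'cV[R]_n)); last first.
  by rewrite {1}(matrix_sum_delta v); apply: eq_bigr => j _; rewrite big_ord1.
rewrite linear_sum /=; apply/colP => i; rewrite summxE mxE.
by apply: eq_bigr => j _; rewrite linearZ !mxE mulrC.
Qed.

Section DataFit.
Variables (R : realType) (n m : nat) (A : 'cV[R]_n -> 'cV[R]_m) (b : 'cV[R]_m).
Variable sigma : R.
Hypotheses (A_C1 : C1 A) (sigma_gt0 : 0 < sigma).

Definition datafit x : R := 1 / (2 * sigma ^+ 2) * norm2 (A x - b) ^+ 2.

Definition datafit_grad x : 'cV[R]_n :=
  (sigma ^+ 2)^-1 *: ((Jacobian A x)^T *m (A x - b)).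

Lemma continuous_residual : continuous (fun x => A x - b).
Proof.
move=> x; have [dA _] := A_C1.
exact: (cvgB (differentiable_continuous (dA x)) (cvg_cst b)).
Qed.

Lemma continuous_datafit_grad : continuous datafit_grad.
Proof.
have [_ cJ] := A_C1.
have c := continuous_mulmx (continuous_trmx cJ) continuous_residual.
by move=> x; exact: (cvgZl_tmp (c x)).
Qed.

Lemma is_derive_datafit x v : is_derive x v datafit (dot (datafit_grad x) v).
Proof.
have [/(_ x) dA _] := A_C1.
have dAv : derivable A x v by exact: diff_derivable.
have dAi i : is_derive x v (fun y => A y i 0) ((Jacobian A x *m v) i 0).
  have /derivable_mxP/(_ i 0) dAvi := dAv.
  apply: DeriveDef => //.
  by rewrite -Jacobian_mulE -deriveE // derive_mx // mxE.
(* Rewritten as a combination of scalar functions, so that the derivative is inferred from the rules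
   for sums and powers. *)
have -> : datafit = (1 / (2 * sigma ^+ 2)) \*:
    (\sum_(i < m) ((fun y => A y i 0) - cst (b i 0)) ^+ 2).
  apply/funext => y; rewrite /datafit norm2_sqr /= fct_sumE.
  by congr (_ * _); apply: eq_bigr => i _; rewrite !mxE -expr2.
apply: is_derive_eq.
rewrite /datafit_grad dotZl -dot_mulmxr /dot !scaler_sumr mulr_sumr.
apply: eq_bigr => i _; rewrite !mxE /GRing.scale /= subr0 expr1.
rewrite -[(_ - cst _) x]/(A x i 0 - b i 0).
by field; rewrite gt_eqF.
Qed.

Lemma datafit_subgradient : strictly_convex datafit -> is_subgradient datafit datafit_grad.
Proof.
move=> fconv u v; have [df <-] := is_derive_datafit u (v - u).
exact: strictly_convex_derive_le.
Qed.

(** On the graph of [D] the coupling term vanishes. As [x] maps linearly and injectively to this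
    graph, without decreasing the norm, strict convexity and coercivity pass to [datafit]. *)
Lemma datafit_fjoint l (D : 'M[R]_(l, n)) lambda x :
  datafit x = fjoint A D b sigma lambda 0 0 x (D *m x).
Proof.
by rewrite /fjoint subrr addr0 mul0r addr0 (norm2_sqr (0 : 'cV_l)) dot0l mulr0 addr0.
Qed.

Lemma datafit_strictly_convex l (D : 'M[R]_(l, n)) lambda :
  strictly_convex (fun p : 'cV[R]_n * 'cV[R]_l =>
    fjoint A D b sigma lambda 0 0 p.1 p.2) ->
  strictly_convex datafit.
Proof.
move=> jconv u v t uv t0 t1; rewrite !(datafit_fjoint D lambda).
have := jconv (u, D *m u) (v, D *m v) t _ t0 t1.
rewrite xpair_eqE (negbTE uv) => /(_ isT) /=.
by rewrite !scalemxAr -mulmxDr.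
Qed.

Lemma datafit_coercive l (D : 'M[R]_(l, n)) lambda :
  coercive (fun p : 'cV[R]_n * 'cV[R]_l =>
    fjoint A D b sigma lambda 0 0 p.1 p.2) ->
  coercive datafit.
Proof.
move=> jco M; have [r rM] := jco M; exists r => x rx.
rewrite (datafit_fjoint D lambda); apply: (rM (x, D *m x)).
by apply: le_trans rx _; rewrite prod_normE le_max lexx.
Qed.

End DataFit.

Lemma coercive_ge (R : realType) (V : normedModType R) (f g : V -> R) :
  coercive f -> (forall x, f x <= g x) -> coercive g.
Proof.
move=> fco fg M; have [r rM] := fco M; exists r => v /rM fM.
exact: le_trans (fg v).
Qed.

(** * Scalar soft thresholding and the l1 norm *)

Section SoftThreshold.
Variables (R : realType) (tau : R).
Hypothesis tau_ge0 : 0 <= tau.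

(** The proximal map of tau |.|; [shrink] applies it in each coordinate with threshold
    [mu / lambda ^+ 2]. *)
Definition soft (w : R) : R := Num.sg w * Num.max (`|w| - tau) 0.

(** The residual is the projection of [w] onto the interval from [- tau] to [tau]; its bound and its
    continuity are read off this form. *)
Lemma soft_residualE w : w - soft w = Num.max (- tau) (Num.min tau w).
Proof.
have t0 := tau_ge0; rewrite /soft; case: sgrP => [->|w0|w0].
- by rewrite mul0r subr0 min_r // max_r // oppr_le0.
- rewrite mul1r; have [wt|wt] := leP (w - tau) 0.
    by rewrite min_r ?max_r; lra.
  by rewrite min_l ?max_r; lra.
- have [wt|wt] := leP (- w - tau) 0.
    by rewrite min_r ?max_r; lra.
  by rewrite min_r ?max_l; lra.
Qed.

Lemma soft_residual_le w : `|w - soft w| <= tau.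
Proof.
by rewrite soft_residualE ler_norml le_max lexx ge_max ge_min lexx (ge0_cp tau_ge0).
Qed.

Lemma soft_residual_mul w : (w - soft w) * soft w = tau * `|soft w|.
Proof.
rewrite /soft; case: sgrP => [->|w0|w0].
- by rewrite !mul0r normr0 !mulr0.
- rewrite !mul1r; have [wt|wt] := leP (w - tau) 0; first by rewrite normr0 !mulr0.
  by rewrite gtr0_norm //; ring.
- have [wt|wt] := leP (- w - tau) 0; first by rewrite mulr0 normr0 !mulr0.
  by rewrite mulN1r normrN gtr0_norm //; ring.
Qed.

(** A number is a subgradient of tau |.| at a point as soon as its modulus is at most [tau] and its
    product with the point is [tau] times the modulus of the point. *)
Lemma soft_residual_subgradient w y :
  tau * `|soft w| + (w - soft w) * (y - soft w) <= tau * `|y|.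
Proof.
rewrite mulrBr soft_residual_mul addrCA subrr addr0.
apply: le_trans (ler_norm _) _.
by rewrite normrM ler_wpM2r // soft_residual_le.
Qed.

Lemma continuous_soft_residual : continuous (fun w => w - soft w).
Proof.
under eq_fun do rewrite soft_residualE.
suff c w : {for w, continuous ((cst (- tau) : R -> R^o) \max (cst tau \min id))}.
  exact: c.
apply: continuous_max; first exact: cst_continuous.
by apply: continuous_min; [exact: cst_continuous|exact: cvg_id].
Qed.

End SoftThreshold.

Lemma norm1_le_norm (R : realType) (l : nat) (v : 'cV[R]_l) :
  norm1 v <= l%:R * `|v|.
Proof.
have -> : l%:R * `|v| = \sum_(i < l) `|v|.
  by rewrite sumr_const card_ord mulr_natl.
by apply: ler_sum => i _; exact: normmx_ge_coord.
Qed.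

Lemma norm1_ge0 (R : realType) (l : nat) (v : 'cV[R]_l) : 0 <= norm1 v.
Proof. exact: sumr_ge0. Qed.

Lemma norm1D (R : realType) (l : nat) (u v : 'cV[R]_l) :
  norm1 (u + v) <= norm1 u + norm1 v.
Proof.
by rewrite -big_split; apply: ler_sum => i _; rewrite mxE ler_normD.
Qed.

Lemma norm1Z (R : realType) (l : nat) (a : R) (v : 'cV[R]_l) :
  norm1 (a *: v) = `|a| * norm1 v.
Proof. by rewrite mulr_sumr; apply: eq_bigr => i _; rewrite mxE normrM. Qed.

(** * The projected objective and the inner loop *)

Section Projected.
Variables (R : realType) (n m l : nat) (A : 'cV[R]_n -> 'cV[R]_m).
Variables (D : 'M[R]_(l, n)) (b : 'cV[R]_m) (sigma lambda mu : R).
Hypotheses (A_C1 : C1 A) (sigma_gt0 : 0 < sigma).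
Hypotheses (lambda_gt0 : 0 < lambda) (mu_ge0 : 0 <= mu).
Hypothesis fit_convex : strictly_convex (datafit A b sigma).
Hypothesis fit_coercive : coercive (datafit A b sigma).

Local Notation fit := (datafit A b sigma).
Local Notation gfit := (datafit_grad A b sigma).
Local Notation shr := (shrink D lambda mu).

(* The residual [D x - y_z(x) + z], which the multiplier update turns into the
   next multiplier. *)
Definition multiplier z x : 'cV[R]_l := D *m x - shr z x + z.

Definition fproj_grad z x : 'cV[R]_n :=
  gfit x + lambda ^+ 2 *: (D^T *m multiplier z x).

Let tau := mu / lambda ^+ 2.

Let lambda2_gt0 : 0 < lambda ^+ 2. Proof. exact: exprn_gt0. Qed.
Let tau_ge0 : 0 <= tau. Proof. by rewrite divr_ge0 // ltW. Qed.

Lemma shrinkE z x i : shr z x i 0 = soft tau ((D *m x + z) i 0).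
Proof. by rewrite mxE. Qed.

Lemma multiplierE z x i :
  multiplier z x i 0 = (D *m x + z) i 0 - soft tau ((D *m x + z) i 0).
Proof. by rewrite -shrinkE /multiplier addrAC !mxE. Qed.

Lemma multiplier_bound z x : `|multiplier z x| <= tau.
Proof.
by apply: normmx_le => // i j; rewrite ord1 multiplierE soft_residual_le.
Qed.

(** Optimality of the shrinkage in y: the scaled residual is a subgradient of mu |.|_1 there. It is
    the scalar inequality multiplied by [lambda ^+ 2] and summed over coordinates. *)
Lemma multiplier_subgradient z x y :
  mu * norm1 (shr z x) + lambda ^+ 2 * dot (multiplier z x) (y - shr z x)
    <= mu * norm1 y.
Proof.
rewrite !mulr_sumr -big_split; apply: ler_sum => i _ /=.
have := soft_residual_subgradient tau_ge0 ((D *m x + z) i 0) (y i 0).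
rewrite -multiplierE -shrinkE => ineq.
have muE : mu = lambda ^+ 2 * tau by rewrite /tau; field; rewrite gt_eqF.
rewrite [(y - _) i 0]mxE [(- shr z x) i 0]mxE.
have := ler_wpM2l (ltW lambda2_gt0) ineq.
by rewrite mulrDr !(mulrA _ tau) -muE.
Qed.

Lemma continuous_multiplier z : continuous (multiplier z).
Proof.
apply: continuous_mx => i j; rewrite (ord1 j).
under eq_fun do rewrite multiplierE.
have cw : continuous (fun x : 'cV[R]_n => (D *m x + z) i 0).
  apply: continuous_coord => x.
  exact: (cvgD (@continuous_mulmxl _ _ _ 1 D x) (cvg_cst z)).
move=> x; apply: (@continuous_comp _ _ _ (fun x : 'cV[R]_n => (D *m x + z) i 0)
  (fun w => w - soft tau w)); first exact: cw.
exact: continuous_soft_residual.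
Qed.

Lemma continuous_fproj_grad z : continuous (fproj_grad z).
Proof.
have cD : continuous (fun x => D^T *m multiplier z x).
  move=> x; apply: (@continuous_comp _ _ _ (multiplier z) (fun v => D^T *m v)).
    exact: continuous_multiplier.
  exact: continuous_mulmxl.
have cg := @continuous_datafit_grad _ _ _ _ b sigma A_C1.
by move=> x; exact: (cvgD (cg x) (cvgZl_tmp (cD x))).
Qed.

Lemma fprojE z x : fproj A D b sigma lambda mu z x =
  fit x + (lambda ^+ 2 / 2 * dot (multiplier z x) (multiplier z x)
           + mu * norm1 (shr z x)).
Proof. by rewrite addrA -norm2_sqr. Qed.

(* Expand |q|^2 >= |p|^2 + 2 <p, q - p> for the two multipliers p, q; the l1
   part is [multiplier_subgradient]. *)
Lemma envelope_subgradient z u v :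
  lambda ^+ 2 / 2 * dot (multiplier z u) (multiplier z u) + mu * norm1 (shr z u)
    + dot (lambda ^+ 2 *: (D^T *m multiplier z u)) (v - u)
  <= lambda ^+ 2 / 2 * dot (multiplier z v) (multiplier z v) + mu * norm1 (shr z v).
Proof.
rewrite dotZl -dot_mulmxr.
have := multiplier_subgradient z u (shr z v).
set p := multiplier z u; set q := multiplier z v.
have -> : D *m (v - u) = (q - p) + (shr z v - shr z u).
  rewrite mulmxBr /p /q /multiplier.
  by apply/colP => i; rewrite !mxE; ring.
have sq : 0 <= lambda ^+ 2 * (dot q q - 2 * dot p q + dot p p).
  apply: mulr_ge0; [exact: ltW|have := dot_ge0 (q - p)].
  by rewrite dotBr !dotBl (dotC q p); lra.
by clearbody p q; rewrite !dotDr !dotNr; lra.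
Qed.

(** With the continuity of [fproj_grad], this identifies it as the gradient of [fproj], despite the
    kinks of the shrinkage map. *)
Lemma fproj_subgradient z :
  is_subgradient (fproj A D b sigma lambda mu z) (fproj_grad z).
Proof.
move=> u v; rewrite !fprojE (dotDl (gfit u)).
have := datafit_subgradient A_C1 sigma_gt0 fit_convex u v.
by have := envelope_subgradient z u v; lra.
Qed.

(** The subgradient vanishes at a minimizer; the data fit makes the inequality strict there, while
    the envelope adds a weak one. *)
Lemma fproj_minimizer_uniq z u v :
  is_minimizer (fproj A D b sigma lambda mu z) u ->
  fproj A D b sigma lambda mu z v <= fproj A D b sigma lambda mu z u -> v = u.
Proof.
move=> umin; apply: contraTeq; rewrite eq_sym => uv; rewrite -ltNge.
have := minimizer_subgradient0 (fproj_subgradient z) (@continuous_fproj_grad z) umin.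
move=> g0; have : dot (fproj_grad z u) (v - u) = 0 by rewrite g0 dot0l.
rewrite !fprojE (dotDl (gfit u)).
have := strictly_convex_subgradient_lt fit_convex
  (datafit_subgradient A_C1 sigma_gt0 fit_convex) uv.
by have := envelope_subgradient z u v; lra.
Qed.

Lemma fproj_coercive z : coercive (fproj A D b sigma lambda mu z).
Proof.
apply: coercive_ge fit_coercive _ => x; rewrite fprojE lerDl.
by rewrite addr_ge0 // mulr_ge0 ?dot_ge0 ?norm1_ge0 // divr_ge0 // ltW.
Qed.

Lemma inner_loop_cvg z x0 xs P alpha beta :
  0 < beta -> inner_loop (fproj A D b sigma lambda mu z) x0 xs P alpha ->
  angle_condition (fproj A D b sigma lambda mu z) xs P beta ->
  exact_steps (fproj A D b sigma lambda mu z) xs P alpha ->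
  exists2 xhat, xs j @[j --> \oo] --> xhat & fproj_grad z xhat = 0.
Proof.
move=> beta0 loop ang exact_.
have fG := fproj_subgradient z; have cG := @continuous_fproj_grad z.
have cf := subgradient_continuous fG cG.
have [xhat xmin] := coercive_minimizer cf (fproj_coercive z).
exists xhat; last exact: (minimizer_subgradient0 fG cG xmin).
apply: (descent_cvg fG cG beta0 loop ang exact_ (fproj_coercive z)) => x.
exact: fproj_minimizer_uniq.
Qed.

(** * The Lasso objective, Lagrangian duality and the outer loop *)

Lemma lasso_strictly_convex : strictly_convex (lasso A D b sigma mu).
Proof.
move=> u v t uv t0 t1; have := fit_convex uv t0 t1.
rewrite /lasso -!/(fit _) mulmxDr -!scalemxAr.
have := norm1D (t *: (D *m u)) ((1 - t) *: (D *m v)).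
rewrite !norm1Z !gtr0_norm ?subr_gt0 // => /(ler_wpM2l mu_ge0).
by rewrite mulrDr; nra.
Qed.

Lemma lasso_coercive : coercive (lasso A D b sigma mu).
Proof.
by apply: coercive_ge fit_coercive _ => x; rewrite lerDl mulr_ge0 ?norm1_ge0.
Qed.

Lemma continuous_lasso : continuous (lasso A D b sigma mu).
Proof.
have cfit := subgradient_continuous (datafit_subgradient A_C1 sigma_gt0 fit_convex)
  (@continuous_datafit_grad _ _ _ _ b sigma A_C1).
have cn : continuous (fun x : 'cV[R]_n => norm1 (D *m x)).
  apply: continuous_bigsum => i.
  have cDi : continuous (fun x : 'cV[R]_n => (D *m x) i 0).
    by apply: continuous_coord => x; exact: (@continuous_mulmxl _ _ _ 1 D x).
  by move=> x; exact: (cvg_norm (cDi x)).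
by move=> x; exact: (cvgD (cfit x) (cvgM (cvg_cst mu) (cn x))).
Qed.

(** The Lagrangian of the Lasso problem split by the constraint y = D x. The multiplier is
    [lambda ^+ 2 *: z], the scaling used by the augmented Lagrangian. *)
Definition lagrangian x y z : R :=
  fit x + mu * norm1 y + lambda ^+ 2 * dot z (D *m x - y).

(** Stationarity makes minus the scaled [D^T *m multiplier z x] the gradient of the data fit. Adding
    its inequality to [multiplier_subgradient], the linear terms combine to the multiplier term of
    the Lagrangian. *)
Lemma lagrangian_min z x x' y' : fproj_grad z x = 0 ->
  lagrangian x (shr z x) (multiplier z x) <= lagrangian x' y' (multiplier z x).
Proof.
move=> g0; rewrite /lagrangian.
have := datafit_subgradient A_C1 sigma_gt0 fit_convex x x'.
have -> : gfit x = - (lambda ^+ 2 *: (D^T *m multiplier z x)).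
  by apply/eqP; rewrite -addr_eq0; apply/eqP.
rewrite dotNl dotZl -dot_mulmxr mulmxBr.
have := multiplier_subgradient z x y'.
by rewrite !dotBr; nra.
Qed.

Section Outer.
Variables (x : nat -> 'cV[R]_n) (y z : nat -> 'cV[R]_l).
Hypothesis x_stationary : forall k, fproj_grad (z k) (x k.+1) = 0.
Hypothesis y_shrink : forall k, y k.+1 = shr (z k) (x k.+1).
Hypothesis z_update : forall k, z k.+1 = D *m x k.+1 - y k.+1 + z k.

Let zE k : z k.+1 = multiplier (z k) (x k.+1).
Proof. by rewrite z_update y_shrink. Qed.

Let d k := lagrangian (x k.+1) (y k.+1) (z k.+1).
Let r k : 'cV[R]_l := D *m x k.+1 - y k.+1.

Lemma dual_le k x' y' : d k <= lagrangian x' y' (z k.+1).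
Proof. by rewrite /d y_shrink zE; exact: lagrangian_min. Qed.

(* [d k] is the dual function at [z k.+1]. *)
Lemma dual_increase k : d k + lambda ^+ 2 * dot (r k.+1) (r k.+1) <= d k.+1.
Proof.
have := dual_le k (x k.+2) (y k.+2); rewrite /d /lagrangian.
rewrite (z_update k.+1) -/(r k.+1) (dotDl (r k.+1)); lra.
Qed.

Lemma dual_le_lasso k x' : d k <= lasso A D b sigma mu x'.
Proof.
(* Weak duality: at a feasible pair the multiplier term vanishes. *)
have := dual_le k x' (D *m x').
by rewrite /lagrangian subrr dotC dot0l mulr0 addr0.
Qed.

Lemma dual_cvg : cvgn d.
Proof.
apply: nondecreasing_is_cvgn; last first.
  by exists (lasso A D b sigma mu 0) => _ [k _ <-]; exact: dual_le_lasso.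
apply/nondecreasing_seqP => k; apply: le_trans (dual_increase k).
by rewrite lerDl mulr_ge0 ?dot_ge0 // ltW.
Qed.

Lemma residual_small e : 0 < e -> \forall k \near \oo, `|r k.+1| <= e.
Proof.
(* Half, because [d k] and [d k.+1] each lie this close to the limit; their difference then bounds
   the squared residual. *)
move=> e0; have le0 : 0 < lambda ^+ 2 * e ^+ 2 / 2.
  by rewrite divr_gt0 // mulr_gt0 // exprn_gt0.
have /cvgrPdist_le/(_ _ le0) [N _ dN] := dual_cvg.
exists N => // k /= Nk.
have := dN k Nk; have := dN k.+1 (leqW Nk).
rewrite !ler_norml => /andP[lo _] /andP[_ hi].
have inc := dual_increase k.
have : lambda ^+ 2 * dot (r k.+1) (r k.+1) <= lambda ^+ 2 * e ^+ 2 by lra.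
rewrite ler_pM2l // -norm2_sqr ler_sqr ?nnegrE ?sqrtr_ge0 ?(ltW e0) //.
by apply: le_trans; exact: norm_le_norm2.
Qed.

(** Passing from [d k] to the Lasso value at [x k.+1] makes two errors, each at most [mu * l%:R]
    times the norm of [r k]: one replaces [y k.+1] by [D *m x k.+1] in the l1 norm, the other drops
    the multiplier term, controlled by [multiplier_bound]. *)
Lemma lasso_le_residual k x' :
  lasso A D b sigma mu (x k.+1) <=
  lasso A D b sigma mu x' + 2 * mu * l%:R * `|r k|.
Proof.
have dual := dual_le_lasso k x'; rewrite /d /lagrangian -/(r k) in dual.
have Dx : D *m x k.+1 = y k.+1 + r k by rewrite /r addrC subrK.
have l1_tri := ler_wpM2l mu_ge0 (norm1D (y k.+1) (r k)); rewrite -Dx mulrDr in l1_tri.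
pose e : R := l%:R * `|r k|.
have l1_r : mu * norm1 (r k) <= mu * e by exact: ler_wpM2l (norm1_le_norm _).
have zr : - (tau * e) <= dot (z k.+1) (r k).
  have := dot_le_norm (z k.+1) (r k); rewrite ler_norml => /andP[+ _].
  apply: le_trans; rewrite lerN2 /e mulrCA mulrA ler_wpM2r // ler_wpM2l // zE.
  exact: multiplier_bound.
have := ler_wpM2l (ltW lambda2_gt0) zr.
rewrite mulrN mulrA [_ * tau]mulrC divfK ?gt_eqF // => zr2.
rewrite {1}/lasso -/(fit _) -[2 * mu * _ * _]mulrA -/e; lra.
Qed.

Lemma outer_cvg xhat : is_minimizer (lasso A D b sigma mu) xhat ->
  x k @[k --> \oo] --> xhat.
Proof.
move=> xmin; apply: (minimizing_sequence_cvg continuous_lasso lasso_coercive).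
  by move=> u; exact: strictly_convex_minimizer_uniq lasso_strictly_convex xmin.
(* The added 1 keeps [c] positive when [l] or [mu] is zero. *)
move=> e e0; pose c := 2 * mu * l%:R + 1.
have c0 : 0 < c by rewrite ltr_wpDl // !mulr_ge0.
have [N _ rN] := residual_small (divr_gt0 e0 c0).
(* The value at [x k.+2] is controlled by [r k.+1], which is small from [N] on. *)
exists N.+2 => // -[//|[//|k]] /= Nk.
apply: le_trans (lasso_le_residual _ xhat) _; rewrite lerD2l.
have := rN k Nk; rewrite ler_pdivlMr //; apply: le_trans.
by rewrite [leRHS]mulrC ler_wpM2r // lerDl.
Qed.

End Outer.

End Projected.

Theorem theorem3p4 (R : realType) (n m l : nat)
    (A : 'cV[R]_n -> 'cV[R]_m) (D : 'M[R]_(l, n)) (b : 'cV[R]_m) (sigma : R)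
    (A_C1 : C1 A) (sigma_gt0 : 0 < sigma)
    (fjoint0_strictly_convex : forall (lambda : R) (z : 'cV[R]_l), 0 < lambda ->
       strictly_convex (fun p : 'cV[R]_n * 'cV[R]_l =>
         fjoint A D b sigma lambda 0 z p.1 p.2))
    (fjoint0_coercive : forall (lambda : R) (z : 'cV[R]_l), 0 < lambda ->
       coercive (fun p : 'cV[R]_n * 'cV[R]_l =>
         fjoint A D b sigma lambda 0 z p.1 p.2)) :
  exists mu0 lambda0 : R, 0 < mu0 /\ 0 < lambda0 /\
  forall mu lambda : R, mu0 <= mu -> lambda0 <= lambda ->
  exists xhat : 'cV[R]_n,
    unique (is_minimizer (lasso A D b sigma mu)) xhat /\
    forall (x : nat -> 'cV[R]_n) (y z : nat -> 'cV[R]_l)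
      (xin : nat -> nat -> 'cV[R]_n) (P : nat -> nat -> 'M[R]_n)
      (alpha : nat -> nat -> R) (beta : R),
      vpal A D b sigma lambda mu x y z xin P alpha ->
      0 < beta ->
      (forall k : nat, angle_condition (fproj A D b sigma lambda mu (z k))
                         (xin k) (P k) beta) ->
      (forall k : nat, exact_steps (fproj A D b sigma lambda mu (z k))
                         (xin k) (P k) (alpha k)) ->
      (forall k : nat, cvg (xin k j @[j --> \oo])) /\
      x k @[k --> \oo] --> xhat.
Proof.
(* The data fit involves neither lambda nor z, so one instance of each hypothesis serves all
   parameters. *)
have fit_convex := datafit_strictly_convex (fjoint0_strictly_convex 1 0 ltr01).
have fit_coercive := datafit_coercive (fjoint0_coercive 1 0 ltr01).
exists 1, 1; split; first exact: ltr01.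
split=> [|mu lambda mu1 lambda1]; first exact: ltr01.
have mu_ge0 : 0 <= mu by exact: le_trans ler01 mu1.
have lambda_gt0 : 0 < lambda by exact: lt_le_trans ltr01 lambda1.
have lasso_convex := lasso_strictly_convex D mu_ge0 fit_convex.
have lasso_cont : continuous (lasso A D b sigma mu) by exact: continuous_lasso.
have [xhat xmin] := coercive_minimizer lasso_cont
  (lasso_coercive D mu_ge0 fit_coercive).
exists xhat; split.
  split=> // u umin; apply/esym.
  exact: (strictly_convex_minimizer_uniq lasso_convex xmin (umin xhat)).
move=> x y z xin P alpha beta [_ _ _ run] beta0 ang ex.
have inner k : exists2 w, xin k j @[j --> \oo] --> w &
    fproj_grad A D b sigma lambda mu (z k) w = 0.
  have [loop _ _ _] := run k.
  exact: (inner_loop_cvg A_C1 sigma_gt0 lambda_gt0 mu_ge0 fit_convex fit_coercive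
    beta0 loop (ang k) (ex k)).
split=> [k|]; first by have [w xw _] := inner k; exact: cvgP xw.
apply: (@outer_cvg _ _ _ _ A D b sigma lambda mu A_C1 sigma_gt0 lambda_gt0 mu_ge0
  fit_convex fit_coercive x y z _ _ _ xhat xmin) => k; have [_ xE yE zE] := run k => //.
(* The inner iterates do converge, so the total operator [lim] returns their limit [w], and [x k.+1]
   is stationary. *)
by have [w xw w0] := inner k; rewrite xE (cvg_lim _ xw).
Qed.
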